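(* Let $(\mathcal{F}_n)_{n<\omega}$ and $(\mathcal{G}_k)_{k<\omega}$ be totally disjoint sequences of filters on a set $X$ such that $$\mathcal{H}:=\operatorname{Li}_{(n)}\mathcal{F}_n=\operatorname{Li}_{(k)}\mathcal{G}_k .$$ Then the relation $\Delta:=\{(n,k)\in\omega\times\omega:\mathcal{F}_n\#\mathcal{G}_k\}$ is finite-to-finite with cofinite domain and cofinite range, and $$\mathcal{H}=\operatorname{Li}_{(n,k)}(\mathcal{F}_n\vee\mathcal{G}_k),$$ where the contour is taken along the cofinite filter on $\Delta$. Moreover, $\mathcal{F}_n=\bigcap_{k\in\Delta n}(\mathcal{F}_n\vee\mathcal{G}_k)$ for all but finitely many $n$, and $\mathcal{G}_k=\bigcap_{n\in\Delta^{-1}k}(\mathcal{F}_n\vee\mathcal{G}_k)$ for all but finitely many $k$.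
   Context: Filters are proper. The contour of a sequence of filters is $\operatorname{Li}_{(n)}\mathcal{F}_n:=\bigcup_{m<\omega}\bigcap_{n>m}\mathcal{F}_n$; the contour along the cofinite filter on an infinite countable index set $\Delta$ of a family $(\mathcal{H}_{i})_{i\in\Delta}$ is the set of all $A\subset X$ such that $A\in\mathcal{H}_i$ for all but finitely many $i\in\Delta$. Families $\mathcal{A},\mathcal{B}$ of subsets of $X$ mesh, $\mathcal{A}\#\mathcal{B}$, if $A\cap B\neq\varnothing$ for all $A\in\mathcal{A},B\in\mathcal{B}$. If filters $\mathcal{F}_n,\mathcal{G}_k$ mesh, $\mathcal{F}_n\vee\mathcal{G}_k$ is their supremum, the filter generated by $\{F\cap G:F\in\mathcal{F}_n,G\in\mathcal{G}_k\}$. A sequence $(\mathcal{F}_n)_n$ of filters on $X$ is totally disjoint if there is a sequence $(X_n)_n$ of pairwise disjoint subsets of $X$ with $X_n\in\mathcal{F}_n$ for each $n$. Here $\Delta n:=\{k:(n,k)\in\Delta\}$ and $\Delta^{-1}k:=\{n:(n,k)\in\Delta\}$; $\Delta$ is finite-to-finite if all the sets $\Delta n$ and $\Delta^{-1}k$ are finite; its domain is $\{n:\Delta n\ne\varnothing\}$ and its range is $\{k:\Delta^{-1}k\neq\varnothing\}$. *)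

(* Defs.v *)
From mathcomp Require Import all_boot.
From mathcomp Require Import boolp classical_sets functions cardinality filter.

Set Implicit Arguments.
Unset Strict Implicit.
Unset Printing Implicit Defensive.

Local Open Scope classical_set_scope.

Definition totally_disjoint (X : Type) (F : nat -> set_system X) : Prop :=
  exists2 A : nat -> set X, trivIset [set: nat] A & forall n, F n (A n).

Definition contour (X : Type) (F : nat -> set_system X) : set_system X :=
  \bigcup_(m in [set: nat]) \bigcap_(n in [set n | (m < n)%N]) F n.

Definition cofinite_contour (I X : Type) (D : set I)
    (H : I -> set_system X) : set_system X :=
  [set A | finite_set [set i | D i /\ ~ H i A]].

(* [Filter] does not exclude the improper filter: the result is proper exactly
   when the proper filters [F] and [G] mesh. *)
Definition filter_sup (X : Type) (F G : set_system X) : set_system X :=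
  smallest Filter [set A `&` B | A in F & B in G].

Definition mesh_rel (X : Type) (F G : nat -> set_system X) : set (nat * nat) :=
  [set p | F p.1 `#` G p.2].

Definition rel_image (D : set (nat * nat)) (n : nat) : set nat :=
  [set k | D (n, k)].

Definition rel_preimage (D : set (nat * nat)) (k : nat) : set nat :=
  [set n | D (n, k)].

Definition rel_domain (D : set (nat * nat)) : set nat :=
  [set n | rel_image D n !=set0].

Definition rel_range (D : set (nat * nat)) : set nat :=
  [set k | rel_preimage D k !=set0].

Definition finite_to_finite (D : set (nat * nat)) : Prop :=
  (forall n, finite_set (rel_image D n)) /\
  (forall k, finite_set (rel_preimage D k)).

(* Main.v *)
Require Import Defs.
From mathcomp Require Import all_boot.
From mathcomp Require Import boolp classical_sets functions cardinality filter.

(** Everything reduces to showing that almost every [F n] contains the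
    intersection of its suprema with the [G k] meshing with it. Suppose that,
    for infinitely many [n], some [A n] not in [F n] belongs to the supremum of
    [F n] and [G k] for every [k] such that [F n] meshes with [G k]. Total
    disjointness makes all but finitely many [k] irrelevant, so [A n] can be
    enlarged to a set [C n], still not in [F n], which belongs to every [G k].
    Enlarge [C n] once more by those of the first [n] disjoint witnesses [Y k] of
    [G] whose complement is in [F n]. Each [Y k] is then contained in all but
    finitely many of these sets, so that their intersection is in every [G k],
    hence in the contour, hence in almost every [F n]: a contradiction. *)

Local Open Scope classical_set_scope.

Lemma finite_set_natP (A : set nat) :
  finite_set A <-> exists m, forall n, A n -> (n <= m)%N.
Proof.
split=> [/finite_seqP[s ->]|[m Am]].
  by exists (\max_(i <- s) i) => n /= ns; exact: leq_bigmax_seq.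
by apply: (sub_finite_set _ (finite_II m.+1)) => n /Am /=; rewrite ltnS.
Qed.

Lemma cofinite_set_natP (A : set nat) :
  cofinite_set A <-> exists m, forall n, (m < n)%N -> A n.
Proof.
rewrite finite_set_natP; split=> -[m mA]; exists m => n.
  by move=> mn; apply: contrapT => /mA; rewrite leqNgt mn.
by move=> An; rewrite leqNgt; apply/negP => /mA.
Qed.

Lemma filter_forall_ltn {X : Type} {F : set_system X} {FF : Filter F}
    (f : nat -> set X) (n : nat) :
  (forall k, (k < n)%N -> F (f k)) -> F [set x | forall k, (k < n)%N -> f k x].
Proof.
elim: n => [|n IHn] Ff; first exact: filterS filterT.
have Fn := Ff n (ltnSn n).
have /IHn Flt : forall k, (k < n)%N -> F (f k) by move=> k /ltnW kn; exact: Ff.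
apply: filterS (filterI Fn Flt) => x [fn flt] k.
by rewrite ltnS leq_eqVlt => /orP[/eqP->|/flt].
Qed.

Lemma contourP {X : Type} (F : nat -> set_system X) (A : set X) :
  contour F A <-> exists m, forall n, (m < n)%N -> F n A.
Proof. by split=> [[m _]|[m]] Fm; exists m. Qed.

Lemma disjoint_setC_contour {X : Type} {F : nat -> set_system X}
    {FF : forall n, Filter (F n)} {Y : nat -> set X} (n : nat) :
  trivIset [set: nat] Y -> (forall k, F k (Y k)) -> contour F (~` Y n).
Proof.
move=> Ydisj FY; apply/contourP; exists n => m nm.
apply: filterS (FY m) => x Ymx Ynx.
have nE : n = m by apply: Ydisj => //; exists x.
by rewrite nE ltnn in nm.
Qed.

Lemma filter_supE {X : Type} {F G : set_system X} {FF : Filter F}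
    {FG : Filter G} :
  filter_sup F G =
    [set A | exists2 B, F B & exists2 C, G C & B `&` C `<=` A].
Proof.
apply/seteqP; split.
- apply: smallest_sub => [|A [B FB [C GC <-]]]; last by exists B => //; exists C.
  split.
  + by exists setT; [exact: filterT|exists setT; [exact: filterT|]].
  + move=> P Q [B FB [C GC BCP]] [B' FB' [C' GC' BCQ]].
    exists (B `&` B'); first exact: filterI.
    exists (C `&` C'); first exact: filterI.
    by move=> x [[Bx B'x] [Cx C'x]]; split; [exact: BCP|exact: BCQ].
  + move=> P Q PQ [B FB [C GC BCP]].
    by exists B => //; exists C => //; exact: subset_trans PQ.
- move=> A [B FB [C GC BCA]] M [MF]; move/(_ (B `&` C)) => MBC.
  by apply: filterS BCA _; apply: MBC; exists B => //; exists C.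
Qed.

Lemma filter_supC {X : Type} (F G : set_system X) :
  filter_sup F G = filter_sup G F.
Proof.
congr smallest; apply/seteqP.
by split=> A [B FB [C GC <-]]; exists C => //; exists B => //; rewrite setIC.
Qed.

Lemma filter_supl {X : Type} (F G : set_system X) {FF : Filter F}
    {FG : Filter G} : F `<=` filter_sup F G.
Proof.
move=> A FA; rewrite filter_supE; exists A => //.
by exists setT; [exact: filterT|move=> x []].
Qed.

Lemma not_meets_filter_sup {X : Type} (F G : set_system X) {FF : Filter F}
    {FG : Filter G} : ~ F `#` G -> filter_sup F G = setT.
Proof.
move=> nFG; apply/seteqP; split=> // A _; rewrite filter_supE.
apply: contrapT => nA; apply: nFG => B C FB GC; apply/set0P/eqP => BC0.
by apply: nA; exists B => //; exists C => //; rewrite BC0; exact: sub0set.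
Qed.

Lemma rel_preimage_mesh {X : Type} (F G : nat -> set_system X) :
  rel_preimage (mesh_rel F G) = rel_image (mesh_rel G F).
Proof.
by apply/funext => k; apply/seteqP; split=> n; rewrite /rel_preimage /rel_image
  /mesh_rel /= meetsC.
Qed.

Section SameContour.
Context {X : Type} {F G : nat -> set_system X}.
Context {FF : forall n, ProperFilter (F n)} {FG : forall k, ProperFilter (G k)}.
Hypothesis F_disjoint : totally_disjoint F.
Hypothesis FG_contour : contour F = contour G.

(** The [n]-th disjointness witness works: its complement lies in every later [F m], hence in the
    common contour, hence in almost every [G k]. *)
Lemma exists_set_avoiding (n : nat) :
  exists2 B, F n B & exists m, forall k, (m < k)%N -> G k (~` B).
Proof.
have [Y Ydisj FY] := F_disjoint; exists (Y n) => //.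
by apply/contourP; rewrite -FG_contour; exact: disjoint_setC_contour.
Qed.

Lemma finite_rel_image_mesh (n : nat) : finite_set (rel_image (mesh_rel F G) n).
Proof.
have [B FB [m Gm]] := exists_set_avoiding n.
apply/finite_set_natP; exists m => k /(_ _ _ FB) meshB.
rewrite leqNgt; apply/negP => /Gm /meshB.
by case=> x [].
Qed.

(** Each [k] alone admits a suitable set of [F n]. Beyond some [m] a single set avoiding those [G k]
    serves them all, so only the finitely many sets for [k <= m] need to be intersected with it. *)
Lemma exists_residual_set (n : nat) (A : set X) :
  (forall k, filter_sup (F n) (G k) A) ->
  exists2 B, F n B & forall k, G k (A `|` ~` B).
Proof.
move=> supA; have [B FB [m Gm]] := exists_set_avoiding n.
have /choice[f fP] k : exists B', F n B' /\ G k (A `|` ~` B').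
  move: (supA k); rewrite filter_supE => -[B' FB' [C GC BCA]].
  exists B'; split=> //; apply: filterS GC => x Cx.
  by have [B'x|] := pselect (B' x); [left; exact: BCA|right].
exists (B `&` [set x | forall k, (k < m.+1)%N -> f k x]).
  by apply: filterI => //; apply: filter_forall_ltn => k _; exact: (fP k).1.
move=> k; have [mk|km] := ltnP m k.
  by apply: filterS (Gm k mk) => x nBx; right => -[].
by apply: filterS (fP k).2 => x [Ax|nfx]; [left|right => -[_ /(_ k km)]].
Qed.

Hypothesis G_disjoint : totally_disjoint G.

Lemma contour_diagonal (C : nat -> set X) :
  (forall n k, G k (C n)) -> exists m, forall n, (m < n)%N -> F n (C n).
Proof.
move=> GC; have [Y Ydisj GY] := G_disjoint.
(* [E n] is a finite union of sets whose complements lie in [F n], so adding it to [C n] cannot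
   bring the latter into [F n]. *)
pose E n := [set x | exists2 k, F n (~` Y k) & (k < n)%N /\ Y k x].
have FnE n : F n (~` E n).
  have : F n [set x | forall k, (k < n)%N -> F n (~` Y k) -> ~ Y k x].
    apply: filter_forall_ltn => k _.
    have [FYk|nFYk] := pselect (F n (~` Y k)).
      by apply: filterS FYk => x nYx _.
    by apply: filterS filterT => x _ /nFYk.
  by apply: filterS => x nY [k FYk [kn Yx]]; exact: (nY k kn FYk Yx).
suff /contourP[m Fm] : contour F [set x | forall n, (C n `|` E n) x].
  exists m => n /Fm FCE; apply: filterS (filterI FCE (FnE n)) => x [CEx nEx].
  by case: (CEx n).
rewrite FG_contour; apply/contourP; exists 0 => k _.
have /contourP[m Fm] : contour F (~` Y k).
  by rewrite FG_contour; exact: disjoint_setC_contour.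
(* On [Y k], the indices [n > maxn m k] are covered by [E n], which then contains [Y k]; only
   finitely many [C n] remain. *)
have Glt : G k [set x | forall n, (n < (maxn m k).+1)%N -> C n x].
  by apply: filter_forall_ltn => n _; exact: GC.
apply: filterS (filterI (GY k) Glt) => x [Yx Cx] n.
have [mkn|] := ltnP (maxn m k) n; last by rewrite -ltnS => /Cx; left.
move: mkn; rewrite gtn_max => /andP[mn kn].
by right; exists k; [exact: Fm|split].
Qed.

Lemma bigcap_filter_sup_sub : exists m, forall n, (m < n)%N ->
  \bigcap_(k in rel_image (mesh_rel F G) n) filter_sup (F n) (G k) `<=` F n.
Proof.
(* [C n] tests the inclusion at [n]: it is [setT] if the inclusion holds, and otherwise a set
   outside [F n], which makes the implication vacuous. *)
have /choice[C CP] n : exists C, (forall k, G k C) /\ (F n C ->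
    \bigcap_(k in rel_image (mesh_rel F G) n) filter_sup (F n) (G k) `<=` F n).
  set I := (X in X `<=` _).
  have [IF|/nonsubset[A [IA nFA]]] := pselect (I `<=` F n).
    by exists setT; split=> // k; exact: filterT.
  have [|B FB GB] := @exists_residual_set n A.
    (* For [k] outside the relation the supremum is improper, so it contains [A] too. *)
    move=> k; have [FGk|nFGk] := pselect (F n `#` G k); first exact: IA.
    by rewrite not_meets_filter_sup.
  exists (A `|` ~` B); split=> // FAB; case: nFA.
  by apply: filterS (filterI FAB FB) => x [[]].
have [m Fm] := @contour_diagonal C (fun n k => (CP n).1 k).
by exists m => n /Fm; exact: (CP n).2.
Qed.

Lemma cofinite_filter_eq_bigcap_sup : cofinite_set [set n |
  F n = \bigcap_(k in rel_image (mesh_rel F G) n) filter_sup (F n) (G k)].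
Proof.
have [m Fm] := bigcap_filter_sup_sub; apply/cofinite_set_natP; exists m => n mn.
by apply/seteqP; split; [move=> A FA k _; exact: filter_supl|exact: Fm].
Qed.

(** An intersection over an empty index set would contain [set0], against the properness of
    [F n]. *)
Lemma cofinite_rel_domain_mesh : cofinite_set (rel_domain (mesh_rel F G)).
Proof.
have [m Fm] := bigcap_filter_sup_sub; apply/cofinite_set_natP; exists m => n mn.
apply: contrapT => nD; apply: (@filter_not_empty _ (F n)).
by apply: (Fm n mn set0) => k Dk; case: nD; exists k.
Qed.

Lemma contour_eq_cofinite_contour_sup : contour F =
  cofinite_contour (mesh_rel F G) (fun p => filter_sup (F p.1) (G p.2)).
Proof.
apply/seteqP; split=> A.
- move=> /contourP[m Fm]; rewrite /cofinite_contour /=.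
  (* Exceptional pairs have first coordinate at most [m], and each such row is finite. *)
  have fin : finite_set (`I_m.+1 `*`` rel_image (mesh_rel F G)).
    by apply: finite_setXR => // n _; exact: finite_rel_image_mesh.
  apply: sub_finite_set fin => -[n k] /= [Dnk nA]; split=> //=.
  by rewrite ltnS leqNgt; apply/negP => /Fm FA; apply: nA; exact: filter_supl.
(* Past the largest first coordinate of an exceptional pair, [A] lies in every supremum of the
   row. *)
- move=> /(finite_image fst)/finite_set_natP[m1 mA].
  have [m2 Fm2] := bigcap_filter_sup_sub.
  apply/contourP; exists (maxn m1 m2) => n; rewrite gtn_max => /andP[m1n m2n].
  apply: (Fm2 n m2n A) => k Dnk; apply: contrapT => nA.
  have := mA n (ex_intro2 _ _ (n, k) (conj Dnk nA) erefl).
  by rewrite leqNgt m1n.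
Qed.

End SameContour.

Theorem theorem3p6 (X : Type) (F G : nat -> set_system X) (H : set_system X)
    (F_proper : forall n, ProperFilter (F n))
    (G_proper : forall k, ProperFilter (G k))
    (F_disjoint : totally_disjoint F)
    (G_disjoint : totally_disjoint G)
    (HF : H = contour F)
    (HG : H = contour G) :
  let D := mesh_rel F G in
  [/\ [/\ finite_to_finite D,
          cofinite_set (rel_domain D)
        & cofinite_set (rel_range D)],
      H = cofinite_contour D (fun p => filter_sup (F p.1) (G p.2)),
      cofinite_set
        [set n | F n = \bigcap_(k in rel_image D n) filter_sup (F n) (G k)]
    & cofinite_set
        [set k | G k = \bigcap_(n in rel_preimage D k) filter_sup (F n) (G k)]].
Proof.
have FG_contour : contour F = contour G by rewrite -HF.
have GF_contour := esym FG_contour.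
(* Turning preimages into images of the relation with [F] and [G] exchanged reduces the claims about
   [G] to those about [F]. *)
move=> D; rewrite /finite_to_finite /rel_range !rel_preimage_mesh.
split; [split| | |].
- by split=> [n|k]; exact: finite_rel_image_mesh.
- exact: cofinite_rel_domain_mesh.
- exact: cofinite_rel_domain_mesh.
- by rewrite HF; exact: contour_eq_cofinite_contour_sup.
- exact: cofinite_filter_eq_bigcap_sup.
- apply: sub_cofinite_set
    (cofinite_filter_eq_bigcap_sup G_disjoint GF_contour F_disjoint) => k /= GkE.
  by rewrite {1}GkE; apply: eq_bigcapr => n _; exact: filter_supC.
Qed.
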